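(* Let $f$ and $h$ be analytic in $\mathbb{D}$ with $f\prec h$ in $\mathbb{D}$. Then for every $k\in\{0,1,2,\dots\}$ and every $0\leq r\leq 1/3$, $$\mathcal{M}_{r}\left(s_{k}(f)\right)\leq \mathcal{M}_{r}\left(s_{k}(h)\right).$$
   Context: $\mathbb{D}=\{z\in\mathbb{C}:|z|<1\}$. For an analytic function $f(z)=\sum_{n=0}^{\infty}a_nz^n$ in $\mathbb{D}$ and $0\le r<1$, the Bohr operator is $\mathcal{M}_r(f)=\sum_{n=0}^{\infty}|a_n|r^n$ (with the convention $0^0=1$), and the $k$-th section of $f$ is the polynomial $s_k(f)=a_0+a_1z+\cdots+a_kz^k$. A Schwarz function is an analytic function $\varphi$ on $\mathbb{D}$ with $\varphi(0)=0$ and $|\varphi(z)|\le 1$ for all $z\in\mathbb{D}$. For analytic $f,h$ in $\mathbb{D}$, $f$ is subordinate to $h$, written $f\prec h$, if there is a Schwarz function $\varphi$ with $f(z)=h(\varphi(z))$ for all $z\in\mathbb{D}$. *)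

(* Defs.v *)
(* Stdlib reals with Coquelicot's complex numbers and power series. *)
From Stdlib Require Import Reals ClassicalEpsilon.
From Coquelicot Require Import Coquelicot.

Definition in_disk (z : C) : Prop := (Cmod z < 1)%R.

Definition has_power_series_at (f : C -> C) (z0 : C) (a : nat -> C) : Prop :=
  exists rho : R, (0 < rho)%R /\
    forall z : C, (Cmod (z - z0) < rho)%R ->
      @is_pseries C_AbsRing C_NormedModule a (z - z0)%C (f z).

(* Functions on the disk are total functions on [C]; only their values inside
   the disk are relevant, since [rho] may always be decreased. *)
Definition analytic_in_disk (f : C -> C) : Prop :=
  forall z0 : C, in_disk z0 -> exists a : nat -> C, has_power_series_at f z0 a.

(* The sequence (a_n) in f(z) = a_0 + a_1 z + a_2 z^2 + ...: it is unique, and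
   exists whenever [f] is analytic at 0.  The value is unspecified otherwise. *)
Definition coef (f : C -> C) : nat -> C :=
  epsilon (inhabits (fun _ : nat => RtoC 0))
    (fun a : nat -> C => has_power_series_at f (RtoC 0) a).

(* [Series] is total; the series converges for [f] analytic in the disk and
   0 <= r < 1.  [pow] satisfies 0 ^ 0 = 1. *)
Definition bohr (r : R) (f : C -> C) : R :=
  Series (fun n : nat => (Cmod (coef f n) * r ^ n)%R).

(* [sum_n u k] is u 0 + ... + u k, with k + 1 terms. *)
Definition kth_section (k : nat) (f : C -> C) : C -> C :=
  fun z : C => sum_n (fun n : nat => (coef f n * z ^ n)%C) k.

Definition schwarz_function (phi : C -> C) : Prop :=
  analytic_in_disk phi /\ phi (RtoC 0) = RtoC 0 /\
  forall z : C, in_disk z -> (Cmod (phi z) <= 1)%R.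

Definition subordinate (f h : C -> C) : Prop :=
  exists phi : C -> C, schwarz_function phi /\
    forall z : C, in_disk z -> f z = h (phi z).

(* Main.v *)
Require Import Defs.
From Stdlib Require Import Arith Reals Lra Lia List Classical ClassicalEpsilon.
From Coquelicot Require Import Coquelicot.

(** Write f = h o phi with phi a Schwarz function, h = sum d_n z^n and
    phi^n = sum_m c_(n,m) z^m.  As phi(0) = 0, c_(n,m) vanishes for m < n, so
    the m-th coefficient of f is the sum of d_n c_(n,m) over n <= m.  Hence the
    majorant sum of s_k(f) is at most the sum over n <= k of
    |d_n| sum_(m <= k) |c_(n,m)| r^m, and it suffices that the inner sum be at
    most r^n.  Now phi = z psi with |psi| <= 1 on the circle, so this is Bohr's
    inequality sum |b_m| r^m <= 1, r <= 1/3, for the function psi^n, multiplied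
    by r^n ([bohr_inequality], [schwarz_pow_majorant], [subordination_majorant]).

    Bohr's inequality follows from Caratheodory's bound |p_j| <= 2 Re p_0 for
    functions P with Re P >= 0 ([caratheodory]).  That bound is usually read off
    an integral of Re P against 2 + 2 Re (c z^-j) on the circle.  Here it is derived from the maximum principle alone: on the unit
    circle the polar part of c z^-j P is traded for its reflection, a polynomial
    with the same real part ([regular_reflect]), and the resulting function
    without a pole is evaluated at 0.

    The maximum principle ([maximum_principle]) is in turn proved without
    integrals, for functions with a complex Taylor expansion of order 2 at each
    point: Re g + e |z|^2 cannot have an interior maximum, because averaging
    over four symmetric directions cancels the terms of degree 1 and 2 of g.
    So neither Cauchy's theorem nor the convergence of the Taylor series in the
    whole disk is involved: near each point a local expansion suffices, and
    coefficients at 0 are identified through the uniqueness of finite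
    expansions ([jet_unique]).

    Working on the closed unit disk requires functions expandable across the
    unit circle, so f and phi are replaced by f(t z) and phi(t z) with t < 1,
    and t tends to 1 at the end ([sum_le_of_dilations]). *)

Open Scope R_scope.

(** * Errors of a given order at the origin *)

(** Keeping the estimate on a whole ball, including
    [w = 0], makes an error of order at least 1 vanish at the origin. *)
Definition bigO (n : nat) (E : C -> C) : Prop :=
  exists M d : R, 0 <= M /\ 0 < d /\
    forall w : C, Cmod w < d -> Cmod (E w) <= M * Cmod w ^ n.

Lemma bigO_ext (n : nat) (E F : C -> C) :
  (forall w, E w = F w) -> bigO n E -> bigO n F.
Proof.
  intros H (M & d & HM & Hd & HE); exists M, d; repeat split; trivial.
  intros w Hw; rewrite <- H; auto.
Qed.

Lemma bigO_ext_near (n : nat) (d : R) (E F : C -> C) :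
  0 < d -> (forall w, Cmod w < d -> E w = F w) -> bigO n E -> bigO n F.
Proof.
  intros Hd H (M & e & HM & He & HE); exists M, (Rmin d e).
  repeat split; [trivial | now apply Rmin_glb_lt |].
  intros w Hw; pose proof (Rmin_l d e); pose proof (Rmin_r d e).
  rewrite <- H by lra; apply HE; lra.
Qed.

Lemma bigO_plus (n : nat) (E F : C -> C) :
  bigO n E -> bigO n F -> bigO n (fun w => E w + F w)%C.
Proof.
  intros (M & d & HM & Hd & HE) (N & e & HN & He & HF).
  exists (M + N), (Rmin d e); repeat split.
  - lra.
  - now apply Rmin_glb_lt.
  - intros w Hw.
    pose proof (Rmin_l d e); pose proof (Rmin_r d e).
    pose proof (Cmod_triangle (E w) (F w)).
    pose proof (HE w ltac:(lra)); pose proof (HF w ltac:(lra)); lra.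
Qed.

Lemma bigO_mult (n m : nat) (E F : C -> C) :
  bigO n E -> bigO m F -> bigO (n + m) (fun w => E w * F w)%C.
Proof.
  intros (M & d & HM & Hd & HE) (N & e & HN & He & HF).
  exists (M * N), (Rmin d e); repeat split.
  - now apply Rmult_le_pos.
  - now apply Rmin_glb_lt.
  - intros w Hw.
    pose proof (Rmin_l d e); pose proof (Rmin_r d e).
    rewrite Cmod_mult, pow_add.
    replace (M * N * (Cmod w ^ n * Cmod w ^ m))
      with (M * Cmod w ^ n * (N * Cmod w ^ m)) by ring.
    apply Rmult_le_compat; try apply Cmod_ge_0; [apply HE | apply HF]; lra.
Qed.

Lemma bigO_const (c : C) : bigO 0 (fun _ => c).
Proof.
  exists (Cmod c), 1; repeat split; try lra; try apply Cmod_ge_0.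
  intros w _; simpl; lra.
Qed.

Lemma bigO_pow (n : nat) : bigO n (fun w => w ^ n)%C.
Proof.
  exists 1, 1; repeat split; try lra.
  intros w _; rewrite Cmod_pow; lra.
Qed.

Lemma bigO_scal (n : nat) (c : C) (E : C -> C) :
  bigO n E -> bigO n (fun w => c * E w)%C.
Proof. exact (bigO_mult 0 n _ _ (bigO_const c)). Qed.

Lemma bigO_minus (n : nat) (E F : C -> C) :
  bigO n E -> bigO n F -> bigO n (fun w => E w - F w)%C.
Proof.
  intros HE HF; apply bigO_ext with (fun w => E w + (- (1)) * F w)%C.
  - intros w; ring.
  - now apply bigO_plus; [| apply bigO_scal].
Qed.

Lemma bigO_weaken (n m : nat) (E : C -> C) :
  (m <= n)%nat -> bigO n E -> bigO m E.
Proof.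
  intros Hmn (M & d & HM & Hd & HE).
  exists M, (Rmin d 1); repeat split; trivial.
  - apply Rmin_glb_lt; lra.
  - intros w Hw.
    pose proof (Rmin_l d 1); pose proof (Rmin_r d 1).
    apply Rle_trans with (1 := HE w ltac:(lra)).
    apply Rmult_le_compat_l; trivial.
    replace n with (m + (n - m))%nat by lia.
    pose proof (Cmod_ge_0 w).
    assert (Cmod w ^ (n - m) <= 1)
      by (rewrite <- (pow1 (n - m)); apply pow_incr; lra).
    pose proof (pow_le (Cmod w) m ltac:(lra)).
    rewrite pow_add; nra.
Qed.

Lemma bigO_comp (n : nat) (E F : C -> C) :
  bigO n E -> bigO 1 F -> bigO n (fun w => E (F w)).
Proof.
  intros (M & d & HM & Hd & HE) (N & e & HN & He & HF).
  exists (M * N ^ n), (Rmin e (d / (N + 1))); repeat split.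
  - apply Rmult_le_pos; trivial; now apply pow_le.
  - apply Rmin_glb_lt; trivial; apply Rdiv_lt_0_compat; lra.
  - intros w Hw.
    pose proof (Rmin_l e (d / (N + 1))); pose proof (Rmin_r e (d / (N + 1))).
    assert (Hw' : Cmod w < d / (N + 1)) by lra.
    apply (Rmult_lt_compat_r (N + 1)) in Hw'; [| lra].
    unfold Rdiv in Hw'; rewrite Rmult_assoc, Rinv_l in Hw' by lra.
    specialize (HF w ltac:(lra)); simpl in HF; rewrite Rmult_1_r in HF.
    pose proof (Cmod_ge_0 w).
    eapply Rle_trans; [apply HE; lra |].
    rewrite Rmult_assoc, <- Rpow_mult_distr.
    apply Rmult_le_compat_l; trivial.
    apply pow_incr; split; [apply Cmod_ge_0 | trivial].
Qed.

(** * Polynomials *)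

Definition taylor (a : nat -> C) (K : nat) (w : C) : C :=
  sum_n (fun i => (a i * w ^ i)%C) K.

Definition shift (a : nat -> C) (i : nat) : C := a (S i).

Lemma taylor_0 (a : nat -> C) (w : C) : taylor a 0 w = a 0%nat.
Proof. unfold taylor; rewrite sum_O; simpl; ring. Qed.

Lemma taylor_S (a : nat -> C) (K : nat) (w : C) :
  taylor a (S K) w = (taylor a K w + a (S K) * w ^ S K)%C.
Proof. exact (sum_Sn _ K). Qed.

(** The Horner step.  Inductions on the order of a polynomial below peel off
    the constant term with it rather than the top term, because dividing by
    [w] lowers the order of an error by exactly one. *)
Lemma taylor_shift (a : nat -> C) (K : nat) (w : C) :
  taylor a (S K) w = (a 0%nat + w * taylor (shift a) K w)%C.
Proof.
  induction K as [| K IH].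
  - rewrite taylor_S, !taylor_0; unfold shift; simpl; ring.
  - rewrite taylor_S, IH, (taylor_S (shift a)); unfold shift; simpl; ring.
Qed.

Lemma taylor_at_0 (a : nat -> C) (K : nat) : taylor a K 0 = a 0%nat.
Proof.
  destruct K; [apply taylor_0 |]; rewrite taylor_shift; ring.
Qed.

Lemma taylor_ext (a b : nat -> C) (K : nat) (w : C) :
  (forall i, (i <= K)%nat -> a i = b i) -> taylor a K w = taylor b K w.
Proof.
  intros H; apply sum_n_ext_loc; intros i Hi; now rewrite H.
Qed.

Lemma taylor_plus (a b : nat -> C) (K : nat) (w : C) :
  taylor (fun i => a i + b i)%C K w = (taylor a K w + taylor b K w)%C.
Proof.
  induction K as [| K IH].
  - now rewrite !taylor_0.
  - rewrite !taylor_S, IH; ring.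
Qed.

Lemma taylor_scal (c : C) (a : nat -> C) (K : nat) (w : C) :
  taylor (fun i => c * a i)%C K w = (c * taylor a K w)%C.
Proof.
  induction K as [| K IH].
  - now rewrite !taylor_0.
  - rewrite !taylor_S, IH; ring.
Qed.

Lemma taylor_bounded (a : nat -> C) (K : nat) : bigO 0 (taylor a K).
Proof.
  induction K as [| K IH].
  - apply bigO_ext with (2 := bigO_const (a 0%nat)).
    intros w; now rewrite taylor_0.
  - apply bigO_ext with (fun w => taylor a K w + a (S K) * w ^ S K)%C.
    + intros w; now rewrite taylor_S.
    + apply bigO_plus; trivial; apply bigO_scal.
      apply bigO_weaken with (S K); [lia | apply bigO_pow].
Qed.

Lemma taylor_minus_0 (a : nat -> C) (K : nat) :
  bigO 1 (fun w => taylor a K w - a 0%nat)%C.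
Proof.
  destruct K as [| K].
  - apply bigO_ext with (fun w => 0 * w ^ 1)%C.
    + intros w; rewrite taylor_0; ring.
    + apply bigO_scal, bigO_pow.
  - apply bigO_ext with (fun w => w ^ 1 * taylor (shift a) K w)%C.
    + intros w; rewrite taylor_shift; ring.
    + exact (bigO_mult 1 0 _ _ (bigO_pow 1) (taylor_bounded _ K)).
Qed.

Lemma le_0_of_le_linear (x M d : R) :
  0 < d -> (forall t, 0 < t < d -> x <= M * t) -> x <= 0.
Proof.
  intros Hd H; apply Rnot_lt_le; intros Hx.
  pose proof (Rabs_pos M); pose proof (Rle_abs M).
  set (t := Rmin (d / 2) (x / (2 * (Rabs M + 1)))).
  assert (Ht : 0 < t) by (apply Rmin_glb_lt; [lra | apply Rdiv_lt_0_compat; lra]).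
  assert (Htd : t <= d / 2) by apply Rmin_l.
  assert (Htx : t <= x / (2 * (Rabs M + 1))) by apply Rmin_r.
  pose proof (H t ltac:(lra)).
  apply (Rmult_le_compat_r (2 * (Rabs M + 1))) in Htx; [| lra].
  unfold Rdiv in Htx; rewrite Rmult_assoc, Rinv_l in Htx by lra.
  nra.
Qed.

(** A polynomial of degree at most [K] cannot be of order [K + 1] at the origin:
    letting [w] tend to 0 kills the constant term, and what is left is divisible
    by [w].  Excluding [w = 0] from the hypothesis is what lets this division be
    iterated. *)
Lemma taylor_coef_0 (a : nat -> C) (K : nat) (M d : R) :
  0 < d ->
  (forall w : C, w <> 0%C -> Cmod w < d ->
     Cmod (taylor a K w) <= M * Cmod w ^ S K) ->
  forall i, (i <= K)%nat -> a i = 0%C.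
Proof.
  revert a; induction K as [K IH] using lt_wf_ind; intros a Hd H.
  assert (Ha : a 0%nat = 0%C).
  { apply Cmod_eq_0, Rle_antisym; [| apply Cmod_ge_0].
    destruct (taylor_minus_0 a K) as (B & e & HB & He & Hbd).
    apply (le_0_of_le_linear _ (Rabs M + B) (Rmin 1 (Rmin d e))).
    - repeat apply Rmin_glb_lt; lra.
    - intros t [Ht Htm].
      assert (t < 1) by (eapply Rlt_le_trans; [apply Htm | apply Rmin_l]).
      assert (Htm' : t < Rmin d e)
        by (eapply Rlt_le_trans; [apply Htm | apply Rmin_r]).
      pose proof (Rmin_l d e); pose proof (Rmin_r d e).
      assert (Hmt : Cmod (RtoC t) = t) by (rewrite Cmod_R; apply Rabs_pos_eq; lra).
      assert (Hne : RtoC t <> 0%C) by (apply Cmod_gt_0; lra).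
      pose proof (H (RtoC t) Hne ltac:(lra)) as Hsmall.
      pose proof (Hbd (RtoC t) ltac:(lra)) as Hlin.
      rewrite Hmt in Hsmall, Hlin; simpl in Hsmall, Hlin.
      replace (a 0%nat)
        with (taylor a K t + - (taylor a K t - a 0%nat))%C by ring.
      eapply Rle_trans; [apply Cmod_triangle |].
      rewrite Cmod_opp.
      assert (t ^ K <= 1) by (rewrite <- (pow1 K); apply pow_incr; lra).
      pose proof (pow_le t K ltac:(lra)).
      pose proof (Rle_abs M); pose proof (Rabs_pos M).
      assert (M * (t * t ^ K) <= Rabs M * t).
      { apply Rle_trans with (Rabs M * (t * t ^ K)).
        - apply Rmult_le_compat_r; [apply Rmult_le_pos |]; lra.
        - apply Rmult_le_compat_l; nra. }
      lra. }
  intros [| i] Hi; trivial.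
  destruct K as [| K]; [lia |].
  apply (IH K ltac:(lia) (shift a) Hd); [| lia].
  intros w Hw Hwd.
  assert (Hpos : 0 < Cmod w) by now apply Cmod_gt_0.
  apply Rmult_le_reg_l with (Cmod w); trivial.
  rewrite <- Cmod_mult.
  replace (w * taylor (shift a) K w)%C with (taylor a (S K) w)
    by (rewrite taylor_shift, Ha; ring).
  eapply Rle_trans; [now apply H |]; simpl; lra.
Qed.

(** * Taylor expansions of finite order *)

(** Taylor expansions of a finite order replace power series: they are all that
    the argument uses, and unlike power series they pass to products, quotients
    and compositions by elementary estimates. *)
Definition jet (K : nat) (g : C -> C) (z0 : C) (a : nat -> C) : Prop :=
  bigO (S K) (fun w => g (z0 + w) - taylor a K w)%C.

Lemma jet_ext (K : nat) (g h : C -> C) (z0 : C) (a : nat -> C) :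
  (forall z, g z = h z) -> jet K g z0 a -> jet K h z0 a.
Proof. intros H; apply bigO_ext; intros w; now rewrite H. Qed.

Lemma jet_coef_ext (K : nat) (g : C -> C) (z0 : C) (a b : nat -> C) :
  (forall i, (i <= K)%nat -> a i = b i) -> jet K g z0 a -> jet K g z0 b.
Proof.
  intros H; apply bigO_ext; intros w; now rewrite (taylor_ext a b).
Qed.

Lemma jet_value (K : nat) (g : C -> C) (z0 : C) (a : nat -> C) :
  jet K g z0 a -> g z0 = a 0%nat.
Proof.
  intros (M & d & HM & Hd & H).
  specialize (H 0%C); rewrite Cmod_0, taylor_at_0, Cplus_0_r in H.
  specialize (H Hd); rewrite pow_i, Rmult_0_r in H by lia.
  replace (g z0) with (g z0 - a 0%nat + a 0%nat)%C by ring.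
  rewrite (Cmod_eq_0 (g z0 - a 0%nat)); [ring |].
  apply Rle_antisym; trivial; apply Cmod_ge_0.
Qed.

Lemma jet_pred (K : nat) (g : C -> C) (z0 : C) (a : nat -> C) :
  jet (S K) g z0 a -> jet K g z0 a.
Proof.
  intros H.
  apply bigO_ext with
    (fun w => (g (z0 + w) - taylor a (S K) w) + a (S K) * w ^ S K)%C.
  - intros w; rewrite taylor_S; ring.
  - apply bigO_plus; [apply bigO_weaken with (2 := H); lia |].
    apply bigO_scal, bigO_pow.
Qed.

Lemma jet_le (K L : nat) (g : C -> C) (z0 : C) (a : nat -> C) :
  (L <= K)%nat -> jet K g z0 a -> jet L g z0 a.
Proof.
  induction 1 as [| K HK IH]; trivial; intros H; apply IH, jet_pred, H.
Qed.

Lemma jet_bounded (K : nat) (g : C -> C) (z0 : C) (a : nat -> C) :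
  jet K g z0 a -> bigO 0 (fun w => g (z0 + w)%C).
Proof.
  intros H.
  apply bigO_ext with
    (fun w => (g (z0 + w) - taylor a K w) + taylor a K w)%C.
  - intros w; ring.
  - apply bigO_plus; [apply bigO_weaken with (2 := H); lia |].
    apply taylor_bounded.
Qed.

Lemma jet_unique (K : nat) (g : C -> C) (z0 : C) (a b : nat -> C) :
  jet K g z0 a -> jet K g z0 b -> forall i, (i <= K)%nat -> a i = b i.
Proof.
  intros Ha Hb i Hi.
  destruct (bigO_minus _ _ _ Hb Ha) as (M & d & _ & Hd & H).
  assert (E : (a i + - (1) * b i)%C = 0%C).
  { apply (taylor_coef_0 (fun i => a i + - (1) * b i)%C K M d Hd); trivial.
    intros w _ Hw.
    rewrite taylor_plus, taylor_scal.
    eapply Rle_trans; [| now apply H].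
    right; f_equal; ring. }
  replace (a i) with (a i + - (1) * b i + b i)%C by ring.
  rewrite E; ring.
Qed.

Lemma jet_plus (K : nat) (g h : C -> C) (z0 : C) (a b : nat -> C) :
  jet K g z0 a -> jet K h z0 b ->
  jet K (fun z => g z + h z)%C z0 (fun i => a i + b i)%C.
Proof.
  intros Ha Hb; apply bigO_ext with (2 := bigO_plus _ _ _ Ha Hb).
  intros w; rewrite taylor_plus; ring.
Qed.

Lemma jet_scal (K : nat) (c : C) (g : C -> C) (z0 : C) (a : nat -> C) :
  jet K g z0 a -> jet K (fun z => c * g z)%C z0 (fun i => c * a i)%C.
Proof.
  intros Ha; apply bigO_ext with (2 := bigO_scal _ c _ Ha).
  intros w; rewrite taylor_scal; ring.
Qed.

Definition conv (a b : nat -> C) (m : nat) : C :=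
  sum_n (fun i => (a i * b (m - i)%nat)%C) m.

Lemma sum_n_S_first (u : nat -> C) (m : nat) :
  sum_n u (S m) = (u 0%nat + sum_n (shift u) m)%C.
Proof.
  induction m as [| m IH].
  - rewrite sum_Sn, !sum_O; reflexivity.
  - rewrite sum_Sn, IH, (sum_Sn (shift u)).
    unfold plus, shift; simpl; ring.
Qed.

Lemma conv_S (a b : nat -> C) (m : nat) :
  conv a b (S m) = (a 0%nat * b (S m) + conv (shift a) b m)%C.
Proof. exact (sum_n_S_first _ m). Qed.

(** Truncating a product of two polynomials only discards terms of higher order. *)
Lemma taylor_mult (a b : nat -> C) (K : nat) :
  bigO (S K) (fun w => taylor a K w * taylor b K w - taylor (conv a b) K w)%C.
Proof.
  revert a; induction K as [| K IH]; intros a.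
  - apply bigO_ext with (fun w => 0 * w ^ 1)%C.
    + intros w; rewrite !taylor_0; unfold conv; rewrite sum_O; simpl; ring.
    + apply bigO_scal, bigO_pow.
  - apply bigO_ext with (fun w =>
      w ^ 1 * (taylor (shift a) K w * taylor b K w - taylor (conv (shift a) b) K w)
      + b (S K) * (w ^ S (S K) * taylor (shift a) K w))%C.
    + intros w.
      assert (E : taylor (conv a b) (S K) w =
        (a 0%nat * taylor b (S K) w + w * taylor (conv (shift a) b) K w)%C).
      { rewrite !taylor_shift, <- (Cmult_1_r (a 0%nat)) at 1.
        unfold conv at 1; rewrite sum_O, Nat.sub_0_r.
        replace (taylor (shift (conv a b)) K w) with
          (a 0%nat * taylor (shift b) K w + taylor (conv (shift a) b) K w)%C.
        - ring.
        - rewrite <- taylor_scal, <- taylor_plus.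
          apply taylor_ext; intros i _; unfold shift at 1 3.
          now rewrite conv_S. }
      rewrite E, (taylor_shift a), (taylor_S b); simpl; ring.
    + apply bigO_plus.
      * exact (bigO_mult 1 (S K) _ _ (bigO_pow 1) (IH (shift a))).
      * apply bigO_scal; rewrite <- (Nat.add_0_r (S (S K))).
        apply bigO_mult; [rewrite Nat.add_0_r; apply bigO_pow | apply taylor_bounded].
Qed.

Lemma jet_mult (K : nat) (g h : C -> C) (z0 : C) (a b : nat -> C) :
  jet K g z0 a -> jet K h z0 b ->
  jet K (fun z => g z * h z)%C z0 (conv a b).
Proof.
  intros Ha Hb.
  apply bigO_ext with (fun w =>
    (g (z0 + w) - taylor a K w) * h (z0 + w)
    + (taylor a K w * (h (z0 + w) - taylor b K w)
       + (taylor a K w * taylor b K w - taylor (conv a b) K w)))%C.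
  - intros w; ring.
  - apply bigO_plus; [| apply bigO_plus].
    + rewrite <- (Nat.add_0_r (S K)).
      exact (bigO_mult _ _ _ _ Ha (jet_bounded _ _ _ _ Hb)).
    + exact (bigO_mult 0 (S K) _ _ (taylor_bounded a K) Hb).
    + apply taylor_mult.
Qed.

Definition const_coef (c : C) (i : nat) : C :=
  match i with 0%nat => c | _ => 0%C end.

Lemma taylor_const_coef (c : C) (K : nat) (w : C) : taylor (const_coef c) K w = c.
Proof.
  induction K as [| K IH]; [apply taylor_0 |].
  rewrite taylor_S, IH; simpl; ring.
Qed.

Lemma jet_const (K : nat) (c z0 : C) : jet K (fun _ => c) z0 (const_coef c).
Proof.
  apply bigO_ext with (fun w => 0 * w ^ S K)%C.
  - intros w; rewrite taylor_const_coef; ring.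
  - apply bigO_scal, bigO_pow.
Qed.

(** The error of the truncated geometric series for [1 / (z0 + w)] is an explicit
    multiple of [w ^ (K + 1) / (z0 + w)]. *)
Lemma jet_inv (K : nat) (z0 : C) :
  z0 <> 0%C -> jet K Cinv z0 (fun i => (- (1)) ^ i / z0 ^ S i)%C.
Proof.
  intros Hz.
  assert (Hpos : 0 < Cmod z0) by now apply Cmod_gt_0.
  assert (Hne : forall w, Cmod w < Cmod z0 / 2 -> (z0 + w)%C <> 0%C).
  { intros w Hw E.
    assert (E' : Cmod z0 = Cmod w).
    { replace z0 with (- w)%C; [apply Cmod_opp |].
      replace (- w)%C with (z0 - (z0 + w))%C by ring; rewrite E; ring. }
    lra. }
  assert (Hbd : bigO 0 (fun w => / (z0 + w))%C).
  { exists (2 / Cmod z0), (Cmod z0 / 2); repeat split.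
    - apply Rlt_le, Rdiv_lt_0_compat; lra.
    - lra.
    - intros w Hw; rewrite Cmod_inv by now apply Hne.
      simpl; rewrite Rmult_1_r.
      replace (2 / Cmod z0) with (/ (Cmod z0 / 2)) by (field; lra).
      apply Rinv_le_contravar; [lra |].
      pose proof (Cmod_triangle (z0 + w) (- w)) as Ht.
      rewrite Cmod_opp in Ht.
      replace (z0 + w + - w)%C with z0 in Ht by ring; lra. }
  apply bigO_ext_near with (d := Cmod z0 / 2)
    (E := fun w => ((- (1)) ^ S K / z0 ^ S K * (w ^ S K * / (z0 + w)))%C).
  - lra.
  - intros w Hw; specialize (Hne w Hw).
    assert (Hp : forall n, (z0 ^ n)%C <> 0%C) by (intros n; now apply Cpow_nz).
    induction K as [| K IH].
    + rewrite taylor_0; simpl; field; auto.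
    + rewrite taylor_S.
      replace (/ (z0 + w) - (taylor (fun i => (- (1)) ^ i / z0 ^ S i) K w
                + (- (1)) ^ S K / z0 ^ S (S K) * w ^ S K))%C
        with ((/ (z0 + w) - taylor (fun i => (- (1)) ^ i / z0 ^ S i) K w)
                - (- (1)) ^ S K / z0 ^ S (S K) * w ^ S K)%C by ring.
      rewrite <- IH; simpl; field; auto.
  - apply bigO_scal; rewrite <- (Nat.add_0_r (S K)) at 1.
    apply (bigO_mult (S K) 0); [apply bigO_pow | apply Hbd].
Qed.

Lemma jet_scale (K : nat) (f : C -> C) (c z0 : C) (a : nat -> C) :
  jet K f (c * z0)%C a -> jet K (fun z => f (c * z)%C) z0 (fun i => c ^ i * a i)%C.
Proof.
  intros H.
  assert (Hc : bigO 1 (fun w => c * w)%C).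
  { apply bigO_scal.
    apply bigO_ext with (2 := bigO_pow 1); intros w; simpl; ring. }
  apply bigO_ext with (2 := bigO_comp _ _ _ H Hc); intros w.
  rewrite Cmult_plus_distr_l.
  replace (taylor a K (c * w)) with (taylor (fun i => c ^ i * a i)%C K w); trivial.
  apply sum_n_ext; intros i; rewrite Cpow_mult_l.
  change (c ^ i * a i * w ^ i = a i * (c ^ i * w ^ i))%C; ring.
Qed.

Lemma jet_continuous (K : nat) (g : C -> C) (z0 : C) (a : nat -> C) (e : R) :
  jet K g z0 a -> 0 < e ->
  exists d, 0 < d /\ forall w, Cmod w < d -> Cmod (g (z0 + w) - g z0)%C < e.
Proof.
  intros H He.
  rewrite (jet_value _ _ _ _ H).
  destruct (jet_le _ 0 _ _ _ (Nat.le_0_l K) H) as (M & d & HM & Hd & HE).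
  exists (Rmin d (e / (M + 1))); split.
  - apply Rmin_glb_lt; trivial; apply Rdiv_lt_0_compat; lra.
  - intros w Hw.
    pose proof (Rmin_l d (e / (M + 1))); pose proof (Rmin_r d (e / (M + 1))).
    specialize (HE w ltac:(lra)); rewrite taylor_0 in HE.
    apply Rle_lt_trans with (1 := HE).
    assert (Hw' : Cmod w < e / (M + 1)) by lra.
    apply (Rmult_lt_compat_r (M + 1)) in Hw'; [| lra].
    unfold Rdiv in Hw'; rewrite Rmult_assoc, Rinv_l in Hw' by lra.
    pose proof (Cmod_ge_0 w); simpl; nra.
Qed.

Definition unshift (a : nat -> C) (m : nat) : C :=
  match m with 0%nat => 0%C | S m => a m end.

Lemma jets_mult_id (g : C -> C) (a : nat -> C) :
  (forall K, jet K g 0 a) -> forall K, jet K (fun z => z * g z)%C 0 (unshift a).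
Proof.
  intros H K; apply jet_pred.
  apply bigO_ext with (fun w => w ^ 1 * (g (0 + w) - taylor a K w))%C.
  - intros w; rewrite taylor_shift.
    change (shift (unshift a)) with a; rewrite Cplus_0_l; simpl; ring.
  - apply (bigO_mult 1 (S K)); [apply bigO_pow | apply H].
Qed.

(** * Functions on the closed unit disk *)

(** An expansion of order 2 has an error of order 3, negligible against the term
    |z|^2 that the maximum principle below adds to the real part. *)
Definition two_jets (g : C -> C) : Prop :=
  forall z, Cmod z <= 1 -> exists b, jet 2 g z b.

(** Dividing by [z] costs one order at the origin, where the zero is, and nothing
    elsewhere; hence all orders at the origin and only order 2 at other points. *)
Definition regular (g : C -> C) (a : nat -> C) : Prop :=
  two_jets g /\ forall K, jet K g 0 a.

Lemma two_jets_plus (g h : C -> C) :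
  two_jets g -> two_jets h -> two_jets (fun z => g z + h z)%C.
Proof.
  intros Hg Hh z Hz; destruct (Hg z Hz) as [a Ha], (Hh z Hz) as [b Hb].
  eexists; apply jet_plus; eassumption.
Qed.

Lemma two_jets_mult (g h : C -> C) :
  two_jets g -> two_jets h -> two_jets (fun z => g z * h z)%C.
Proof.
  intros Hg Hh z Hz; destruct (Hg z Hz) as [a Ha], (Hh z Hz) as [b Hb].
  eexists; apply jet_mult; eassumption.
Qed.

Lemma two_jets_const (c : C) : two_jets (fun _ => c).
Proof. intros z _; eexists; apply jet_const. Qed.

Lemma two_jets_id : two_jets (fun z => z).
Proof.
  intros z _.
  exists (fun i => match i with 0%nat => z | S i => const_coef 1 i end).
  apply bigO_ext with (fun w => 0 * w ^ 3)%C.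
  - intros w; rewrite taylor_shift.
    change (shift _) with (const_coef 1); rewrite taylor_const_coef; ring.
  - apply bigO_scal, bigO_pow.
Qed.

Lemma two_jets_pow (n : nat) : two_jets (fun z => z ^ n)%C.
Proof.
  induction n as [| n IH]; [exact (two_jets_const 1) |].
  exact (two_jets_mult _ _ two_jets_id IH).
Qed.

Lemma regular_mult (g h : C -> C) (a b : nat -> C) :
  regular g a -> regular h b -> regular (fun z => g z * h z)%C (conv a b).
Proof.
  intros [Hg Ha] [Hh Hb]; split; [now apply two_jets_mult |].
  intros K; now apply jet_mult.
Qed.

(** Removing a zero at the origin.  Away from 0 the quotient
    [(g z - a 0) / z] is a product of functions with 2-jets; at 0 its jets come
    from those of [g] of one order more. *)
Lemma regular_factor (g : C -> C) (a : nat -> C) :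
  regular g a ->
  exists q, regular q (shift a) /\ forall z, g z = (a 0%nat + z * q z)%C.
Proof.
  intros [Hg Ha].
  set (q := fun z : C => if excluded_middle_informative (z = 0%C) then a 1%nat
                     else ((g z + - a 0%nat) * / z)%C).
  assert (Hq0 : q 0%C = a 1%nat)
    by (unfold q; case excluded_middle_informative; [trivial | now intros []]).
  assert (Hq : forall z : C, z <> 0%C -> q z = ((g z + - a 0%nat) * / z)%C)
    by (intros z Hz; unfold q;
          case excluded_middle_informative; [contradiction | trivial]).
  assert (Hjets : forall K, jet K q 0 (shift a)).
  { intros K; destruct (Ha (S K)) as (M & d & HM & Hd & H).
    exists M, d; repeat split; trivial.
    intros w Hw; specialize (H w Hw); rewrite Cplus_0_l in H |- *.
    destruct (excluded_middle_informative (w = 0%C)) as [-> | Hw0].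
    - rewrite Hq0, taylor_at_0; unfold shift.
      replace (a 1%nat - a 1%nat)%C with (RtoC 0) by ring.
      rewrite Cmod_0, pow_i by lia; lra.
    - assert (Hpos : 0 < Cmod w) by now apply Cmod_gt_0.
      apply Rmult_le_reg_l with (Cmod w); trivial.
      rewrite <- Cmod_mult, Hq by trivial.
      replace (w * ((g w + - a 0%nat) * / w - taylor (shift a) K w))%C
        with (g w - taylor a (S K) w)%C
        by (rewrite taylor_shift; field; trivial).
      apply Rle_trans with (1 := H); simpl; lra. }
  exists q; split; [split; trivial |].
  - intros z Hz.
    destruct (excluded_middle_informative (z = 0%C)) as [-> | Hz0];
      [eexists; apply Hjets |].
    destruct (Hg z Hz) as [b Hb].
    assert (Hpos : 0 < Cmod z) by now apply Cmod_gt_0.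
    eexists.
    apply bigO_ext_near with (d := Cmod z)
      (3 := jet_mult 2 _ _ z _ _
              (jet_plus 2 _ _ z _ _ Hb (jet_const 2 (- a 0%nat)%C z))
              (jet_inv 2 z Hz0)); trivial.
    intros w Hw; rewrite Hq; trivial.
    intros E.
    assert (E' : Cmod z = Cmod w); [| lra].
    replace z with (- w)%C; [apply Cmod_opp |].
    replace (- w)%C with (z - (z + w))%C by ring; rewrite E; ring.
  - intros z; destruct (excluded_middle_informative (z = 0%C)) as [-> | Hz0].
    + rewrite (jet_value 0 g 0 a); [ring | apply Ha].
    + rewrite Hq by trivial; field; trivial.
Qed.

(** * The maximum principle *)

Lemma list_argmax {T : Type} (v : T -> R) (l : list T) :
  l <> nil -> exists t, In t l /\ forall t', In t' l -> v t' <= v t.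
Proof.
  induction l as [| x l IH]; [easy |]; intros _.
  destruct l as [| y l].
  - exists x; split; [now left |]; intros t' [<- | []]; lra.
  - destruct IH as (t & Ht & Hmax); [easy |].
    destruct (Rle_dec (v t) (v x)).
    + exists x; split; [now left |].
      intros t' [<- | Ht']; [lra |]; specialize (Hmax t' Ht'); lra.
    + exists t; split; [now right |].
      intros t' [<- | Ht']; [lra |]; auto.
Qed.

Lemma Cmod_le_parts (w : C) : Cmod w <= Rabs (Re w) + Rabs (Im w).
Proof.
  replace w with (RtoC (Re w) + Ci * RtoC (Im w))%C at 1.
  - eapply Rle_trans; [apply Cmod_triangle |].
    rewrite Cmod_mult, Cmod_Ci, !Cmod_R; lra.
  - destruct w as [x y]; unfold Ci, RtoC, Cplus, Cmult; simpl; f_equal; ring.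
Qed.

(** An upper semicontinuous function on the closed disk attains its maximum.
    Were it not so, each point would have a neighbourhood on which [u] is beaten
    by the value at some fixed point of the disk.  The best of the finitely many
    points attached to a finite subcover would then be beaten by another one. *)
Lemma disk_argmax (u : C -> R) :
  (forall z e, Cmod z <= 1 -> 0 < e ->
     exists d, 0 < d /\ forall w, Cmod w < d -> u (z + w)%C < u z + e) ->
  exists z, Cmod z <= 1 /\ forall z', Cmod z' <= 1 -> u z' <= u z.
Proof.
  intros Hu; apply NNPP; intros Hno.
  assert (Hbetter : forall z, Cmod z <= 1 -> exists s, Cmod s <= 1 /\ u z < u s).
  { intros z Hz; apply NNPP; intros Hz'; apply Hno; exists z; split; trivial.
    intros z' Hz1; apply Rnot_lt_le; intros Hlt; apply Hz'; now exists z'. }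
  assert (Hloc : forall t : Compactness.Tn 2 R, exists ds : posreal * C,
    Cmod (snd ds) <= 1 /\
    forall z, Cmod z <= 1 -> close_n 2 (fst ds) (Re z, (Im z, tt)) t ->
      u z < u (snd ds)).
  { intros (x & y & []).
    set (z := (x, y) : C).
    assert (Hclose : forall (d : R) (z' : C), 
      close_n 2 d (Re z', (Im z', tt)) (x, (y, tt)) -> Cmod (z' - z)%C < 2 * d).
    { intros d z' (H1 & H2 & _).
      eapply Rle_lt_trans; [apply Cmod_le_parts |].
      unfold z; destruct z' as [x' y']; simpl in *; unfold Rminus in *; lra. }
    destruct (Rle_dec (Cmod z) 1) as [Hz | Hz].
    - destruct (Hbetter z Hz) as (s & Hs & Hlt).
      destruct (Hu z (u s - u z) Hz ltac:(lra)) as (d & Hd & Hdu).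
      assert (Hd2 : 0 < d / 2) by lra.
      exists (mkposreal _ Hd2, s); split; trivial; simpl fst; simpl snd.
      intros z' Hz' Hc; apply Hclose in Hc; simpl in Hc.
      replace z' with (z + (z' - z))%C by ring.
      replace (u s) with (u z + (u s - u z)) by ring.
      apply Hdu; lra.
    - (* Outside the disk: a ball that misses it, so any point [s] will do. *)
      assert (Hd : 0 < (Cmod z - 1) / 2) by lra.
      exists (mkposreal _ Hd, RtoC 0); split; [simpl; rewrite Cmod_0; lra |].
      intros z' Hz' Hc; apply Hclose in Hc; simpl in Hc.
      pose proof (Cmod_triangle z' (- (z' - z))) as Ht; rewrite Cmod_opp in Ht.
      replace (z' + - (z' - z))%C with z in Ht by ring; lra. }
  destruct (choice _ Hloc) as [F HF].
  apply (compactness_list 2 (-1, (-1, tt)) (1, (1, tt)) (fun t => fst (F t))).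
  intros (l & Hl).
  assert (Hcover : forall z, Cmod z <= 1 ->
    exists t, In t l /\ u z < u (snd (F t))).
  { intros z Hz.
    destruct (Hl (Re z, (Im z, tt))) as (t & Ht & _ & Hc).
    - assert (Hmax := Rmax_Cmod z).
      pose proof (Rmax_l (Rabs (fst z)) (Rabs (snd z))).
      pose proof (Rmax_r (Rabs (fst z)) (Rabs (snd z))).
      assert (-1 <= fst z <= 1) by (apply Rabs_le_between; lra).
      assert (-1 <= snd z <= 1) by (apply Rabs_le_between; lra).
      now repeat split.
    - exists t; split; trivial; now apply HF. }
  destruct (list_argmax (fun t => u (snd (F t))) l) as (t & Ht & Hmax).
  { intros ->; destruct (Hcover 0%C) as (t & [] & _); rewrite Cmod_0; lra. }
  destruct (Hcover (snd (F t))) as (t' & Ht' & Hlt); [apply HF |].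
  specialize (Hmax t' Ht'); simpl in Hmax; lra.
Qed.

(** Average over the four points [z0 + w] with [w] in {t, it, -t, -it}: the linear
    and quadratic terms of [g] cancel, so the mean of [Re g] changes by O(t^3),
    while the mean of |z|^2 increases by t^2. *)
Lemma perturbed_no_interior_max (g : C -> C) (z0 : C) (b : nat -> C) (e : R) :
  jet 2 g z0 b -> 0 < e -> Cmod z0 < 1 ->
  exists z, Cmod z <= 1 /\
    Re (g z0) + e * Cmod z0 ^ 2 < Re (g z) + e * Cmod z ^ 2.
Proof.
  intros Hj He Hz0; apply NNPP; intros Hno.
  rewrite (jet_value _ _ _ _ Hj) in Hno.
  destruct Hj as (M & d & HM & Hd & H).
  (* With M t < e the error 4 M t^3 cannot offset the gain 4 e t^2. *)
  set (t := Rmin (Rmin (d / 2) (1 - Cmod z0)) (e / (M + 1))).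
  assert (Ht : 0 < t).
  { repeat apply Rmin_glb_lt; try lra; apply Rdiv_lt_0_compat; lra. }
  assert (Htd : t <= d / 2) by (eapply Rle_trans; apply Rmin_l).
  assert (Htz : t <= 1 - Cmod z0)
    by (eapply Rle_trans; [apply Rmin_l | apply Rmin_r]).
  assert (Hte : t <= e / (M + 1)) by apply Rmin_r.
  apply (Rmult_le_compat_r (M + 1)) in Hte; [| lra].
  unfold Rdiv in Hte; rewrite Rmult_assoc, Rinv_l in Hte by lra.
  assert (Hdir : forall w, Cmod w = t ->
    Re (taylor b 2 w) - M * t ^ 3 + e * Cmod (z0 + w)%C ^ 2
      <= Re (b 0%nat) + e * Cmod z0 ^ 2).
  { intros w Hw.
    specialize (H w ltac:(lra)); rewrite Hw in H.
    assert (Hre : Rabs (Re (g (z0 + w) - taylor b 2 w)%C) <= M * t ^ 3)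
      by (eapply Rle_trans; [apply re_le_Cmod | apply H]).
    apply Rabs_le_between in Hre.
    unfold Cminus in Hre; rewrite re_plus, re_opp in Hre.
    assert (Hle : Re (g (z0 + w)%C) + e * Cmod (z0 + w)%C ^ 2
                    <= Re (b 0%nat) + e * Cmod z0 ^ 2); [| lra].
    apply Rnot_lt_le; intros Hlt; apply Hno; exists (z0 + w)%C; split; trivial.
    pose proof (Cmod_triangle z0 w); lra. }
  assert (Hmt : Cmod (RtoC t) = t) by (rewrite Cmod_R; apply Rabs_pos_eq; lra).
  pose proof (Hdir (RtoC t) Hmt) as D1.
  pose proof (Hdir (- RtoC t)%C ltac:(now rewrite Cmod_opp)) as D2.
  pose proof (Hdir (Ci * RtoC t)%C
    ltac:(rewrite Cmod_mult, Cmod_Ci, Hmt; ring)) as D3.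
  pose proof (Hdir (- (Ci * RtoC t))%C
    ltac:(rewrite Cmod_opp, Cmod_mult, Cmod_Ci, Hmt; ring)) as D4.
  rewrite !Cmod2_alt, !taylor_S, taylor_0 in D1, D2, D3, D4.
  destruct (b 0%nat) as [b0 b0'], (b 1%nat) as [b1 b1'], (b 2%nat) as [b2 b2'],
    z0 as [x y].
  unfold RtoC, Ci, Cmult, Cplus, Copp, Re, Im in D1, D2, D3, D4; simpl in D1, D2, D3, D4.
  assert (e * (t * t) <= M * (t * (t * t))) by lra.
  assert (0 < t * t) by nra.
  nra.
Qed.

(** The perturbation by e |z|^2 forces the maximum to the boundary
    even when [g] is constant, so that no connectedness argument is needed. *)
Lemma maximum_principle (g : C -> C) (B : R) :
  two_jets g -> (forall z, Cmod z = 1 -> Re (g z) <= B) ->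
  forall z, Cmod z <= 1 -> Re (g z) <= B.
Proof.
  intros Hg HB z Hz; apply le_epsilon; intros e He.
  destruct (disk_argmax (fun z => Re (g z) + e * Cmod z ^ 2)) as (m & Hm & Hmax).
  - intros z1 e1 Hz1 He1; destruct (Hg z1 Hz1) as [b Hb].
    destruct (jet_continuous 2 g z1 b (e1 / 2) Hb ltac:(lra)) as (d & Hd & Hc).
    set (d' := Rmin (Rmin d 1) (e1 / (8 * e))).
    assert (0 < d').
    { repeat apply Rmin_glb_lt; try lra; apply Rdiv_lt_0_compat; lra. }
    exists d'; split; trivial; intros w Hw.
    assert (d' <= d) by (eapply Rle_trans; apply Rmin_l).
    assert (d' <= 1) by (eapply Rle_trans; [apply Rmin_l | apply Rmin_r]).
    assert (Hde : d' <= e1 / (8 * e)) by apply Rmin_r.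
    apply (Rmult_le_compat_r (8 * e)) in Hde; [| lra].
    unfold Rdiv in Hde; rewrite Rmult_assoc, Rinv_l in Hde by lra.
    specialize (Hc w ltac:(lra)).
    pose proof (re_le_Cmod (g (z1 + w) - g z1)%C) as Hre.
    unfold Cminus in Hre; rewrite re_plus, re_opp in Hre.
    pose proof (Rle_abs (Re (g (z1 + w)%C) + - Re (g z1))).
    unfold Cminus in Hc.
    pose proof (Cmod_triangle z1 w); pose proof (Cmod_ge_0 (z1 + w)%C).
    pose proof (Cmod_ge_0 z1); pose proof (Cmod_ge_0 w).
    assert (Cmod (z1 + w)%C ^ 2 <= Cmod z1 ^ 2 + 3 * Cmod w) by nra.
    assert (e * Cmod (z1 + w)%C ^ 2 <= e * Cmod z1 ^ 2 + 3 * (e * Cmod w)) by nra.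
    assert (e * Cmod w < e * d') by nra.
    lra.
  - specialize (Hmax z Hz) as Hmz; simpl in Hmz.
    pose proof (Cmod_ge_0 z).
    assert (0 <= e * (Cmod z * (Cmod z * 1))) by (apply Rmult_le_pos; nra).
    destruct (Rle_lt_or_eq_dec _ _ Hm) as [Hlt | Heq].
    + destruct (Hg m Hm) as [b Hb].
      destruct (perturbed_no_interior_max g m b e Hb He Hlt) as (s & Hs & Hgt).
      specialize (Hmax s Hs); simpl in Hmax, Hgt; lra.
    + specialize (HB m Heq); rewrite Heq in Hmz; lra.
Qed.

(** * Coefficients of functions with nonnegative real part *)

Lemma rotate_to_Cmod (z : C) : exists c : C, Cmod c = 1 /\ (c * z)%C = Cmod z.
Proof.
  destruct (excluded_middle_informative (z = 0%C)) as [-> | Hz].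
  - exists 1%C; rewrite Cmod_1, Cmod_0; split; trivial; ring.
  - assert (Hpos : 0 < Cmod z) by now apply Cmod_gt_0.
    assert (Hne : RtoC (Cmod z) <> 0%C) by (intros E; injection E; lra).
    exists (Cconj z / Cmod z)%C; split.
    + rewrite Cmod_div, Cmod_conj, Cmod_R, Rabs_pos_eq by (trivial; lra).
      field; lra.
    + transitivity ((z * Cconj z) / Cmod z)%C; [field; trivial |].
      rewrite <- Cmod2_conj, RtoC_pow; simpl; field; trivial.
Qed.

(** Multiplying [P] by [z ^ -j] creates the polar terms [p i * z ^ (i - j)] with
    i < j.  On the unit circle, where conj z = 1 / z, each of them, times [c], is
    the conjugate of a term without a pole; these terms make up [R].  Thus
    [c * q + R] has no pole in the disk and has, on the circle, the same real
    part as [c * P * z ^ -j]. *)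
Lemma regular_reflect (P : C -> C) (p : nat -> C) (c : C) (j : nat) :
  regular P p ->
  exists q R : C -> C,
    regular q (fun i => p (j + i)%nat) /\ two_jets R /\ R 0%C = 0%C /\
    forall z, Cmod z = 1 -> (c * P z * Cconj z ^ j = c * q z + Cconj (R z))%C.
Proof.
  intros HP; induction j as [| j (q & R & Hq & HR & HR0 & E)].
  - exists P, (fun _ => 0%C); repeat split; try apply HP.
    + apply two_jets_const.
    + intros z _; simpl; unfold Cconj; simpl.
      replace (0, - 0) with (RtoC 0); [ring |].
      unfold RtoC; f_equal; ring.
  - destruct (regular_factor _ _ Hq) as (q1 & [Hs Hj] & E1).
    rewrite Nat.add_0_r in E1.
    exists q1, (fun z => z * (Cconj (c * p j) + R z))%C; repeat split.
    + exact Hs.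
    + intros K; apply jet_coef_ext with (2 := Hj K).
      intros i _; unfold shift; f_equal; lia.
    + apply two_jets_mult; [apply two_jets_id |].
      apply two_jets_plus; trivial; apply two_jets_const.
    + ring.
    + intros z Hz.
      assert (Hzz : (z * Cconj z = 1)%C)
        by (rewrite <- Cmod2_conj, Hz; f_equal; ring).
      rewrite Cpow_S.
      replace (c * P z * (Cconj z * Cconj z ^ j))%C
        with (Cconj z * (c * P z * Cconj z ^ j))%C by ring.
      rewrite (E z Hz), E1, Cmult_conj, Cplus_conj, Cconj_conj.
      transitivity (Cconj z * (c * p j + Cconj (R z)) + (z * Cconj z) * (c * q1 z))%C;
        [ring |].
      rewrite Hzz; ring.
Qed.

(** On the unit circle [2 + w + conj w], with [w = c * conj z ^ j], is a
    nonnegative real number, hence so is the real part of its product with [P].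
    By reflection this real part is that of a function [Phi] on the disk with
    Phi(0) = 2 p_0 + c p_j, and the maximum principle applied to -Phi gives
    Re (2 p_0 + c p_j) >= 0; then choose [c] with c p_j = - |p_j|. *)
Lemma caratheodory (P : C -> C) (p : nat -> C) (j : nat) :
  regular P p -> (forall z, Cmod z = 1 -> 0 <= Re (P z)) -> (1 <= j)%nat ->
  Cmod (p j) <= 2 * Re (p 0%nat).
Proof.
  intros HP Hpos Hj.
  destruct (rotate_to_Cmod (- p j)%C) as (c & Hc & Hcp).
  destruct (regular_reflect P p c j HP) as (q & R & Hq & HR & HR0 & E).
  set (Phi := fun z => ((2 + Cconj c * z ^ j) * P z + (c * q z + R z))%C).
  assert (HPhi : two_jets Phi).
  { repeat first [apply two_jets_plus | apply two_jets_mult | apply two_jets_const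
      | apply two_jets_pow]; trivial; [apply HP | apply Hq]. }
  assert (Hmax : Re (- (1) * Phi (RtoC 0))%C <= 0).
  { apply (maximum_principle (fun z => - (1) * Phi z)%C).
    - apply two_jets_mult; trivial; apply two_jets_const.
    - intros z Hz.
      set (w := (c * Cconj z ^ j)%C).
      assert (Hw : Cmod w = 1).
      { unfold w; rewrite Cmod_mult, Cmod_pow, Cmod_conj, Hz, Hc, pow1; ring. }
      assert (HRe : Re (Phi z) = Re (P z) * (2 + 2 * Re w)).
      { rewrite <- re_scal_r.
        transitivity (Re ((2 + Cconj c * z ^ j) * P z + (c * q z + Cconj (R z)))%C).
        { unfold Phi; now rewrite !re_plus, re_conj. }
        rewrite <- E by trivial; f_equal.
        rewrite RtoC_plus, RtoC_mult, re_alt.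
        unfold w; rewrite Cmult_conj, <- Cpow_conj, Cconj_conj.
        field; intros E2; injection E2; lra. }
      pose proof (re_le_Cmod w) as Hrw; rewrite Hw in Hrw.
      apply Rabs_le_between in Hrw.
      specialize (Hpos z Hz).
      replace (- (1) * Phi z)%C with (- Phi z)%C by ring.
      rewrite re_opp, HRe; nra.
    - rewrite Cmod_0; lra. }
  assert (E0 : (- (1) * Phi (RtoC 0) = - (2 * p 0%nat) + Cmod (p j))%C).
  { unfold Phi.
    rewrite HR0, (jet_value 0 P 0 p), (jet_value 0 q 0 _ (proj2 Hq 0%nat)),
      Nat.add_0_r by apply HP.
    rewrite Cmod_opp in Hcp; rewrite <- Hcp.
    destruct j as [| j]; [lia |]; simpl; ring. }
  rewrite E0, re_plus, re_opp, re_scal_l, re_RtoC in Hmax; lra.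
Qed.

(** * Majorant series and Bohr's inequality *)

Definition majorant_le (a : nat -> C) (r B : R) : Prop :=
  forall k, sum_n (fun m => Cmod (a m) * r ^ m) k <= B.

Lemma sum_n_S_R (u : nat -> R) (k : nat) : sum_n u (S k) = sum_n u k + u (S k).
Proof. exact (sum_Sn u k). Qed.

Lemma majorant_unshift (a : nat -> C) (r B : R) :
  0 <= r -> majorant_le a r B -> majorant_le (unshift a) r (r * B).
Proof.
  intros Hr H [| k].
  - rewrite sum_O; simpl; rewrite Cmod_0, Rmult_0_l.
    apply Rmult_le_pos; trivial.
    apply Rle_trans with (2 := H 0%nat); rewrite sum_O; simpl.
    rewrite Rmult_1_r; apply Cmod_ge_0.
  - apply Rle_trans with (r * sum_n (fun m => Cmod (a m) * r ^ m) k).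
    + right; induction k as [| k IH].
      * rewrite sum_n_S_R, !sum_O; simpl; rewrite Cmod_0; ring.
      * rewrite sum_n_S_R, IH, (sum_n_S_R _ k); simpl; ring.
    + now apply Rmult_le_compat_l.
Qed.

Lemma majorant_plus (a b : nat -> C) (r A B : R) :
  0 <= r -> majorant_le a r A -> majorant_le b r B ->
  majorant_le (fun i => a i + b i)%C r (A + B).
Proof.
  intros Hr Ha Hb k; specialize (Ha k); specialize (Hb k).
  apply Rle_trans with
    (sum_n (fun m => Cmod (a m) * r ^ m + Cmod (b m) * r ^ m) k).
  - apply sum_n_m_le; intros m.
    pose proof (Cmod_triangle (a m) (b m)); pose proof (pow_le r m Hr); nra.
  - rewrite (sum_n_plus (fun m => Cmod (a m) * r ^ m)).
    now apply Rplus_le_compat.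
Qed.

Lemma majorant_scal (c : C) (a : nat -> C) (r A : R) :
  majorant_le a r A -> majorant_le (fun i => c * a i)%C r (Cmod c * A).
Proof.
  intros Ha k.
  rewrite (sum_n_ext _ (fun m => scal (Cmod c) (Cmod (a m) * r ^ m))).
  - rewrite (sum_n_scal_l (Cmod c) (fun m => Cmod (a m) * r ^ m)).
    apply Rmult_le_compat_l; [apply Cmod_ge_0 | apply Ha].
  - intros m; rewrite Cmod_mult; unfold scal; simpl; unfold mult; simpl; ring.
Qed.

(** Bohr's theorem.  Choose |c| = 1 with c b_0 >= 0; then 1 - c G has nonnegative
    real part, and [caratheodory] bounds every other coefficient by
    2 (1 - |b_0|).  The radius 1/3 is where 2 (r + r^2 + r^3 + ...) reaches 1. *)
Lemma bohr_inequality (G : C -> C) (b : nat -> C) (r : R) :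
  regular G b -> (forall z, Cmod z = 1 -> Cmod (G z) <= 1) ->
  0 <= r <= 1 / 3 -> majorant_le b r 1.
Proof.
  intros [HG Hb] HG1 Hr.
  destruct (rotate_to_Cmod (b 0%nat)) as (c & Hc & Hcb).
  assert (Hcoef : forall j, (1 <= j)%nat -> Cmod (b j) <= 2 * (1 - Cmod (b 0%nat))).
  { intros j Hj.
    assert (HP : regular (fun z => 1 + (- c) * G z)%C
                   (fun i => const_coef 1 i + (- c) * b i)%C).
    { split.
      - apply two_jets_plus; [apply two_jets_const |].
        apply two_jets_mult; [apply two_jets_const | trivial].
      - intros K; apply jet_plus; [apply jet_const | apply jet_scal, Hb]. }
    pose proof (caratheodory _ _ j HP) as H.
    cbv beta in H; change (const_coef 1 0) with (RtoC 1) in H.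
    replace (1 + - c * b 0%nat)%C with (RtoC (1 - Cmod (b 0%nat))) in H
      by (rewrite RtoC_minus, <- Hcb; ring).
    rewrite re_RtoC in H.
    replace (const_coef 1 j + - c * b j)%C with (- (c * b j))%C in H
      by (destruct j; [lia | simpl; ring]).
    rewrite Cmod_opp, Cmod_mult, Hc, Rmult_1_l in H.
    apply H; trivial.
    intros z Hz.
    pose proof (re_le_Cmod (- c * G z)%C) as Hre.
    rewrite Cmod_mult, Cmod_opp, Hc, Rmult_1_l in Hre.
    apply Rabs_le_between in Hre.
    specialize (HG1 z Hz); rewrite re_plus, re_RtoC; lra. }
  assert (H0 : 0 <= 1 - Cmod (b 0%nat)).
  { pose proof (Hcoef 1%nat (le_n _)); pose proof (Cmod_ge_0 (b 1%nat)); lra. }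
  (* The term added to the partial sum is what the remaining coefficients could
     still contribute, by the geometric series of ratio 1/3. *)
  assert (Hsum : forall k, sum_n (fun m => Cmod (b m) * r ^ m) k
                   + (1 - Cmod (b 0%nat)) * (1 / 3) ^ k <= 1).
  { induction k as [| k IH].
    - rewrite sum_O; simpl; lra.
    - rewrite sum_n_S_R.
      assert (Cmod (b (S k)) * r ^ S k <= 2 * (1 - Cmod (b 0%nat)) * (1 / 3) ^ S k).
      { apply Rmult_le_compat; try apply Cmod_ge_0; try (apply pow_le; lra).
        - apply Hcoef; lia.
        - now apply pow_incr. }
      simpl in *; lra. }
  intros k; specialize (Hsum k).
  assert (0 <= (1 - Cmod (b 0%nat)) * (1 / 3) ^ k)
    by (apply Rmult_le_pos; [trivial | apply pow_le; lra]).
  lra.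
Qed.

(** * Majorants of compositions with a Schwarz function *)

Lemma regular_pow (g : C -> C) (a : nat -> C) (n : nat) :
  regular g a -> exists b, regular (fun z => g z ^ n)%C b.
Proof.
  intros Hg; induction n as [| n [b IH]].
  - exists (const_coef 1); split; [exact (two_jets_const 1) |].
    intros K; exact (jet_const K 1 0).
  - exists (conv a b); exact (regular_mult _ _ _ _ Hg IH).
Qed.

(** With phi = z psi, the function psi ^ n is bounded by 1 on the circle, so Bohr's
    inequality applies to it; the factor z ^ n contributes r ^ n. *)
Lemma schwarz_pow_majorant (phi : C -> C) (p : nat -> C) (r : R) (n : nat) :
  regular phi p -> p 0%nat = 0%C -> (forall z, Cmod z = 1 -> Cmod (phi z) <= 1) ->
  0 <= r <= 1 / 3 ->
  exists c, (forall K, jet K (fun z => phi z ^ n)%C 0 c) /\ majorant_le c r (r ^ n).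
Proof.
  intros Hphi Hp0 Hphi1 Hr.
  destruct (regular_factor _ _ Hphi) as (psi & Hpsi & E).
  assert (Hpsi1 : forall z, Cmod z = 1 -> Cmod (psi z) <= 1).
  { intros z Hz; specialize (Hphi1 z Hz).
    rewrite E, Hp0, Cplus_0_l, Cmod_mult, Hz in Hphi1; lra. }
  destruct (regular_pow psi _ n Hpsi) as [b Hb].
  assert (Hbm : majorant_le b r 1).
  { apply (bohr_inequality _ _ _ Hb); trivial.
    intros z Hz; rewrite Cmod_pow, <- (pow1 n).
    apply pow_incr; split; [apply Cmod_ge_0 | auto]. }
  assert (H : forall m, exists c,
    (forall K, jet K (fun z => z ^ m * psi z ^ n)%C 0 c) /\ majorant_le c r (r ^ m)).
  { induction m as [| m (c & Hc & Hcm)].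
    - exists b; split; trivial.
      intros K; apply jet_ext with (2 := proj2 Hb K); intros z; simpl; ring.
    - exists (unshift c); split.
      + intros K; apply jet_ext with (2 := jets_mult_id _ _ Hc K).
        intros z; simpl; ring.
      + apply majorant_unshift; trivial; lra. }
  destruct (H n) as (c & Hc & Hcm); exists c; split; trivial.
  intros K; apply jet_ext with (2 := Hc K).
  intros z; rewrite E, Hp0, Cplus_0_l, Cpow_mult_l; reflexivity.
Qed.

Lemma schwarz_poly_majorant (phi : C -> C) (p d : nat -> C) (r : R) (N : nat) :
  regular phi p -> p 0%nat = 0%C -> (forall z, Cmod z = 1 -> Cmod (phi z) <= 1) ->
  0 <= r <= 1 / 3 ->
  exists s, (forall K, jet K (fun z => taylor d N (phi z)) 0 s) /\
    majorant_le s r (sum_n (fun n => Cmod (d n) * r ^ n) N).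
Proof.
  intros Hphi Hp0 Hphi1 Hr.
  assert (Hterm : forall n, exists s,
    (forall K, jet K (fun z => d n * phi z ^ n)%C 0 s) /\
    majorant_le s r (Cmod (d n) * r ^ n)).
  { intros n; destruct (schwarz_pow_majorant phi p r n) as (c & Hc & Hcm); trivial.
    exists (fun i => d n * c i)%C; split.
    - intros K; now apply jet_scal.
    - now apply majorant_scal. }
  induction N as [| N (s & Hs & Hsm)].
  - destruct (Hterm 0%nat) as (s & Hs & Hsm); exists s; split.
    + intros K; apply jet_ext with (2 := Hs K).
      intros z; rewrite taylor_0; simpl; ring.
    + now rewrite sum_O.
  - destruct (Hterm (S N)) as (s' & Hs' & Hsm').
    exists (fun i => s i + s' i)%C; split.
    + intros K.
      apply jet_ext with (2 := jet_plus K _ _ _ _ _ (Hs K) (Hs' K)).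
      intros z; now rewrite taylor_S.
    + rewrite sum_n_S_R; apply majorant_plus; trivial; lra.
Qed.

(** Only the terms of degree at most [k] of [h] influence the first coefficients
    of h o phi, since phi vanishes at 0.  Hence the [a m] with m <= k are the
    coefficients of the polynomial [taylor d k] composed with phi, which
    [schwarz_poly_majorant] controls. *)
Lemma subordination_majorant (f h phi : C -> C) (a d p : nat -> C) (k : nat) (r : R) :
  jet k f 0 a -> jet k h 0 d -> regular phi p -> p 0%nat = 0%C ->
  (forall z, Cmod z = 1 -> Cmod (phi z) <= 1) ->
  (forall z, Cmod z <= 1 -> f z = h (phi z)) -> 0 <= r <= 1 / 3 ->
  sum_n (fun m => Cmod (a m) * r ^ m) k <= sum_n (fun m => Cmod (d m) * r ^ m) k.
Proof.
  intros Hf Hh Hphi Hp0 Hphi1 E Hr.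
  destruct (schwarz_poly_majorant phi p d r k) as (s & Hs & Hsm); trivial.
  assert (Hfs : jet k f 0 s).
  { apply bigO_ext_near with (d := 1) (E := fun w =>
      ((h (0 + phi (0 + w)) - taylor d k (phi (0 + w)))
       + (taylor d k (phi (0 + w)) - taylor s k w))%C); [lra | |].
    - intros w Hw; rewrite !Cplus_0_l, E by lra; ring.
    - apply bigO_plus; [| apply Hs].
      apply (bigO_comp (S k) (fun w => h (0 + w) - taylor d k w)%C
               (fun w => phi (0 + w)%C)); trivial.
      apply bigO_ext with (2 := proj2 Hphi 0%nat).
      intros w; rewrite taylor_0, Hp0; ring. }
  rewrite (sum_n_ext_loc _ (fun m => Cmod (s m) * r ^ m)); [apply Hsm |].
  intros m Hm; now rewrite (jet_unique k f 0 a s Hf Hfs m Hm).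
Qed.

(** * Power series and their coefficients *)

Lemma pow_n_Cpow (z : C) (n : nat) : @pow_n C_Ring z n = (z ^ n)%C.
Proof. induction n as [| n IH]; simpl; [reflexivity | now rewrite IH]. Qed.

Lemma sum_n_pseries (a : nat -> C) (z : C) (n : nat) :
  sum_n (fun k => @scal C_AbsRing C_NormedModule (pow_n z k) (a k)) n = taylor a n z.
Proof.
  apply sum_n_ext; intros k.
  change (@pow_n C_Ring z k * a k = a k * z ^ k)%C.
  rewrite pow_n_Cpow; ring.
Qed.

Lemma pseries_partial_sums (a : nat -> C) (z l : C) (e : R) :
  @is_pseries C_AbsRing C_NormedModule a z l -> 0 < e ->
  exists N, forall n, (N <= n)%nat -> Cmod (taylor a n z - l)%C < e.
Proof.
  intros H He.
  destruct (proj1 (filterlim_locally_ball_norm _ _) H (mkposreal e He)) as [N HN].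
  exists N; intros n Hn; specialize (HN n Hn).
  unfold ball_norm in HN; rewrite sum_n_pseries in HN.
  exact HN.
Qed.

Lemma pseries_coef_bound (a : nat -> C) (s : R) (l : C) :
  0 < s -> @is_pseries C_AbsRing C_NormedModule a (RtoC s) l ->
  exists B, 0 <= B /\ forall n, Cmod (a n) <= B * (/ s) ^ n.
Proof.
  intros Hs H.
  destruct (filterlim_bounded _ (ex_intro _ l H)) as [M HM].
  assert (HM' : forall n, Cmod (taylor a n s) <= M).
  { intros n; rewrite <- sum_n_pseries; apply HM. }
  assert (HM0 : 0 <= M) by (eapply Rle_trans; [apply Cmod_ge_0 | apply (HM' 0%nat)]).
  assert (Hterm : forall n, Cmod (a n) * s ^ n <= 2 * M).
  { intros n.
    replace (Cmod (a n) * s ^ n) with (Cmod (a n * RtoC s ^ n)%C)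
      by (rewrite Cmod_mult, Cmod_pow, Cmod_R, Rabs_pos_eq by lra; reflexivity).
    destruct n as [| n].
    - specialize (HM' 0%nat); rewrite taylor_0 in HM'.
      simpl; rewrite Cmult_1_r; lra.
    - replace (a (S n) * RtoC s ^ S n)%C
        with (taylor a (S n) s + - taylor a n s)%C by (rewrite taylor_S; ring).
      eapply Rle_trans; [apply Cmod_triangle |]; rewrite Cmod_opp.
      pose proof (HM' n); pose proof (HM' (S n)); lra. }
  exists (2 * M); split; [lra |]; intros n.
  assert (0 < s ^ n) by now apply pow_lt.
  apply Rmult_le_reg_r with (s ^ n); trivial.
  rewrite pow_inv, Rmult_assoc, Rinv_l, Rmult_1_r by lra.
  apply Hterm.
Qed.

(** If |a_n| <= B q^n and q |w| <= 1/2, the terms beyond order [K] are dominated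
    by a geometric series of ratio 1/2. *)
Lemma pseries_jet (f : C -> C) (z0 : C) (a : nat -> C) (K : nat) :
  has_power_series_at f z0 a -> jet K f z0 a.
Proof.
  intros (rho & Hrho & H).
  set (s := rho / 2).
  assert (Hs : 0 < s) by (unfold s; lra).
  assert (Hms : Cmod (RtoC s) = s) by (rewrite Cmod_R; apply Rabs_pos_eq; lra).
  destruct (pseries_coef_bound a s (f (z0 + s)%C) Hs) as (B & HB & Ha).
  { replace (RtoC s) with (z0 + s - z0)%C at 1 by ring.
    apply H; replace (z0 + s - z0)%C with (RtoC s) by ring; rewrite Hms; unfold s; lra. }
  assert (Hq : 0 < / s) by now apply Rinv_0_lt_compat.
  set (q := / s) in *.
  exists (2 * (B * q ^ S K)), (s / 2); repeat split; [| lra |].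
  - pose proof (pow_le q (S K) ltac:(lra)); nra.
  - intros w Hw.
    assert (Hw2 : q * Cmod w <= / 2).
    { apply Rmult_le_reg_l with s; trivial.
      unfold q; rewrite <- Rmult_assoc, Rinv_r by lra; lra. }
    pose proof (Cmod_ge_0 w) as Hw0.
    assert (Htail : forall m, Cmod (taylor a (K + m) w - taylor a K w)%C
        <= 2 * (B * q ^ S K) * Cmod w ^ S K * (1 - (/ 2) ^ m)).
    { induction m as [| m IH].
      - rewrite Nat.add_0_r; simpl pow at 3.
        replace (taylor a K w - taylor a K w)%C with (RtoC 0) by ring.
        rewrite Cmod_0; lra.
      - rewrite Nat.add_succ_r, taylor_S.
        replace (taylor a (K + m) w + a (S (K + m)) * w ^ S (K + m) - taylor a K w)%C
          with (taylor a (K + m) w - taylor a K w + a (S (K + m)) * w ^ S (K + m))%C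
          by ring.
        eapply Rle_trans; [apply Cmod_triangle |].
        assert (Hlast : Cmod (a (S (K + m)) * w ^ S (K + m))%C
                  <= B * q ^ S K * Cmod w ^ S K * (/ 2) ^ m).
        { rewrite Cmod_mult, Cmod_pow.
          apply Rle_trans with (B * q ^ S (K + m) * Cmod w ^ S (K + m)).
          - apply Rmult_le_compat_r; [now apply pow_le | apply Ha].
          - change (S (K + m)) with (S K + m)%nat; rewrite !pow_add.
            replace (B * (q ^ S K * q ^ m) * (Cmod w ^ S K * Cmod w ^ m))
              with (B * q ^ S K * Cmod w ^ S K * (q ^ m * Cmod w ^ m)) by ring.
            apply Rmult_le_compat_l.
            + repeat first [apply pow_le | apply Rmult_le_pos]; lra.
            + rewrite <- Rpow_mult_distr; apply pow_incr; split; trivial.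
              apply Rmult_le_pos; lra. }
        simpl pow at 3; simpl pow in IH, Hlast; simpl pow; lra. }
    assert (Hconst : 0 <= 2 * (B * q ^ S K) * Cmod w ^ S K).
    { repeat first [apply pow_le | apply Rmult_le_pos]; lra. }
    apply le_epsilon; intros e He.
    assert (Hps : @is_pseries C_AbsRing C_NormedModule a w (f (z0 + w)%C)).
    { replace w with (z0 + w - z0)%C at 1 by ring.
      apply H; replace (z0 + w - z0)%C with w by ring; unfold s in Hw; lra. }
    destruct (pseries_partial_sums a w _ e Hps He) as [N HN].
    specialize (HN (K + N)%nat ltac:(lia)); specialize (Htail N).
    replace (f (z0 + w) - taylor a K w)%C
      with (taylor a (K + N) w - taylor a K w + - (taylor a (K + N) w - f (z0 + w)))%C
      by ring.
    eapply Rle_trans; [apply Cmod_triangle |]; rewrite Cmod_opp.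
    pose proof (pow_le (/ 2) N ltac:(lra)); nra.
Qed.

Lemma coef_power_series (f : C -> C) :
  (exists a, has_power_series_at f (RtoC 0) a) ->
  has_power_series_at f (RtoC 0) (coef f).
Proof.
  exact (epsilon_spec (inhabits (fun _ : nat => RtoC 0))
           (fun a => has_power_series_at f (RtoC 0) a)).
Qed.

Lemma coef_unique (f : C -> C) (a : nat -> C) :
  has_power_series_at f (RtoC 0) a -> forall i, coef f i = a i.
Proof.
  intros H i.
  assert (Hc : has_power_series_at f (RtoC 0) (coef f))
    by (apply coef_power_series; now exists a).
  apply (jet_unique i f 0); trivial; now apply pseries_jet.
Qed.

Lemma coef_jet (f : C -> C) (K : nat) : analytic_in_disk f -> jet K f 0 (coef f).
Proof.
  intros Hf; apply pseries_jet, coef_power_series, Hf.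
  unfold in_disk; rewrite Cmod_0; lra.
Qed.

(** Restriction to a smaller concentric disk, rescaled to the unit disk: the
    rescaled function is analytic across the unit circle. *)
Lemma analytic_regular (f : C -> C) (t : R) :
  analytic_in_disk f -> 0 <= t < 1 ->
  regular (fun z => f (RtoC t * z)%C) (fun i => RtoC t ^ i * coef f i)%C.
Proof.
  intros Hf Ht; split.
  - intros z Hz.
    destruct (Hf (RtoC t * z)%C) as [a Ha].
    + unfold in_disk; rewrite Cmod_mult, Cmod_R, Rabs_pos_eq by lra.
      pose proof (Cmod_ge_0 z); nra.
    + eexists; apply jet_scale, pseries_jet, Ha.
  - intros K; apply jet_scale.
    rewrite Cmult_0_r; now apply coef_jet.
Qed.

Lemma is_series_finite {K : AbsRing} {V : NormedModule K} (u : nat -> V) (k : nat) :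
  (forall n, (k < n)%nat -> u n = zero) -> is_series u (sum_n u k).
Proof.
  intros H.
  apply (filterlim_ext_loc (fun _ => sum_n u k)); [| apply filterlim_const].
  exists k; intros n; induction 1 as [| n Hn IH]; trivial.
  rewrite sum_Sn, <- IH, H, plus_zero_r by lia; reflexivity.
Qed.

Lemma coef_section (k : nat) (f : C -> C) (i : nat) :
  coef (kth_section k f) i = if le_dec i k then coef f i else RtoC 0.
Proof.
  apply (coef_unique _ (fun i => if le_dec i k then coef f i else RtoC 0)).
  exists 1; split; [lra |]; intros z _.
  set (b := fun i => _).
  replace (z - 0)%C with z by ring.
  assert (E : kth_section k f z =
    sum_n (fun n => @scal C_AbsRing C_NormedModule (pow_n z n) (b n)) k).
  { rewrite sum_n_pseries.
    apply sum_n_ext_loc; intros n Hn; unfold b.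
    destruct (le_dec n k); [trivial | lia]. }
  rewrite E; apply is_series_finite.
  intros n Hn; unfold b; destruct (le_dec n k); [lia | exact (scal_zero_r _)].
Qed.

Lemma bohr_section (r : R) (k : nat) (f : C -> C) :
  bohr r (kth_section k f) = sum_n (fun n => Cmod (coef f n) * r ^ n) k.
Proof.
  apply is_series_unique.
  replace (sum_n (fun n => Cmod (coef f n) * r ^ n) k)
    with (sum_n (fun n => Cmod (coef (kth_section k f) n) * r ^ n) k).
  - apply (@is_series_finite R_AbsRing R_NormedModule
             (fun n => Cmod (coef (kth_section k f) n) * r ^ n)).
    intros n Hn; rewrite coef_section; destruct (le_dec n k); [lia |].
    rewrite Cmod_0; apply Rmult_0_l.
  - apply sum_n_ext_loc; intros n Hn.
    rewrite coef_section; destruct (le_dec n k); [trivial | lia].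
Qed.

(** * From smaller disks to the unit disk *)

Lemma bernoulli_below (e : R) (k : nat) : 0 <= e <= 1 -> 1 - INR k * e <= (1 - e) ^ k.
Proof.
  intros He; induction k as [| k IH]; [simpl; lra |].
  rewrite S_INR; simpl.
  pose proof (pos_INR k).
  assert (0 <= INR k * (e * e)) by (apply Rmult_le_pos; nra).
  nra.
Qed.

(** Letting [t] tend to 1: all the factors [t ^ m] are at least [t ^ k], which is
    at least 1 - k (1 - t). *)
Lemma sum_le_of_dilations (u : nat -> R) (k : nat) (B : R) :
  (forall m, 0 <= u m) ->
  (forall t, 0 < t < 1 -> sum_n (fun m => t ^ m * u m) k <= B) ->
  sum_n u k <= B.
Proof.
  intros Hu H.
  set (F := sum_n u k).
  assert (HF : 0 <= F).
  { unfold F; clear H; induction k as [| k IH];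
      [rewrite sum_O | rewrite sum_n_S_R; specialize (Hu (S k))]; auto; lra. }
  assert (F - B <= 0); [| lra].
  apply (le_0_of_le_linear _ (INR k * F) 1); [lra |].
  intros e He; specialize (H (1 - e) ltac:(lra)).
  assert (Hlow : (1 - e) ^ k * F <= sum_n (fun m => (1 - e) ^ m * u m) k).
  { unfold F; clear H F HF.
    assert (Hpow : forall n, (n <= k)%nat -> (1 - e) ^ k <= (1 - e) ^ n).
    { intros n Hn; replace k with (n + (k - n))%nat by lia; rewrite pow_add.
      assert ((1 - e) ^ (k - n) <= 1)
        by (rewrite <- (pow1 (k - n)) at 2; apply pow_incr; lra).
      pose proof (pow_le (1 - e) n ltac:(lra)); nra. }
    assert (Hle : forall n, (n <= k)%nat ->
      (1 - e) ^ k * sum_n u n <= sum_n (fun m => (1 - e) ^ m * u m) n).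
    { induction n as [| n IH]; intros Hn; specialize (Hpow _ Hn).
      - rewrite !sum_O; specialize (Hu 0%nat); nra.
      - rewrite !sum_n_S_R, Rmult_plus_distr_l.
        apply Rplus_le_compat; [apply IH; lia |].
        now apply Rmult_le_compat_r. }
    now apply Hle. }
  pose proof (bernoulli_below e k ltac:(lra)); nra.
Qed.

Theorem theorem8 :
  forall f h : C -> C,
    analytic_in_disk f -> analytic_in_disk h -> subordinate f h ->
    forall (k : nat) (r : R), (0 <= r <= 1 / 3)%R ->
      (bohr r (kth_section k f) <= bohr r (kth_section k h))%R.
Proof.
  intros f h Hf Hh (phi & (Hphi & Hphi0 & Hphi1) & E) k r Hr.
  rewrite !bohr_section.
  apply sum_le_of_dilations.
  - intros m; apply Rmult_le_pos; [apply Cmod_ge_0 | now apply pow_le].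
  - intros t Ht.
    assert (Hin : forall z, Cmod z <= 1 -> in_disk (RtoC t * z)%C).
    { intros z Hz; unfold in_disk.
      rewrite Cmod_mult, Cmod_R, Rabs_pos_eq by lra.
      pose proof (Cmod_ge_0 z); nra. }
    rewrite (sum_n_ext _ (fun m => Cmod (RtoC t ^ m * coef f m)%C * r ^ m)).
    + apply (subordination_majorant (fun z => f (RtoC t * z)%C) h
               (fun z => phi (RtoC t * z)%C) _ _
               (fun i => RtoC t ^ i * coef phi i)%C); trivial.
      * apply analytic_regular; [trivial | lra].
      * now apply coef_jet.
      * apply analytic_regular; [trivial | lra].
      * rewrite <- (jet_value 0 phi 0 (coef phi)), Hphi0 by now apply coef_jet.
        ring.
      * intros z Hz; apply Hphi1, Hin; lra.
      * intros z Hz; now apply E, Hin.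
    + intros m; rewrite Cmod_mult, Cmod_pow, Cmod_R, Rabs_pos_eq by lra.
      apply eq_sym, Rmult_assoc.
Qed.
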